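(* Let $d\ge 1$, $\gamma\in(0,1)$, and let $X=\{X_t\}_{t\ge0}$ be a $\gamma$-super-Brownian motion on $\mathbb{R}^d$ whose initial state $X_0$ is a non-random finite measure. Then for any nonnegative bounded Borel function $f$ on $\mathbb{R}^d$ that is not Lebesgue-a.e. zero, $$P\big(T(1)\ne T(f)\big)=0.$$
   Context: For a measure $\mu$ and a function $f$ on $\mathbb{R}^d$, $\langle \mu,f\rangle=\langle f,\mu\rangle=\int f\,d\mu$. Let $p_t(x)=(2\pi t)^{-d/2}e^{-|x|^2/(2t)}$ and $S_tf(x)=\int p_t(x-y)f(y)\,dy$. Log-Laplace semigroup: let $w(x)=C_we^{-|x|}$ with $\int w\,dx=1$. For $f\ge 0$ a bounded Borel function that is not a.e. zero, $V_t(f)(x)=v(t,x)$ denotes the unique nonnegative solution of $$v(t,x)=(S_tf)(x)+\int_0^t (S_{t-s}v^\gamma(s,\cdot))(x)\,ds,\quad t>0,\ x\in\mathbb{R}^d,$$ that is continuous on $(0,\infty)\times\mathbb{R}^d$ and for which $t\mapsto \operatorname{ess\,sup}_x |w(x)v(t,x)|$ is essentially bounded on every compact $[a,b]\subset(0,\infty)$ (existence and uniqueness known, Aguirre and Escobedo). A $\gamma$-super-Brownian motion $X=\{X_t\}_{t\ge0}$ is the measure-valued Markov process on $\mathbb{R}^d$, defined on a filtered probability space $(\Omega,\mathcal{F},\{\mathcal{F}_t\}_{t\ge 0},P)$ and adapted to it, characterized by $$E\big(e^{-\langle X_t,f\rangle}\,\big|\,X_0=\mu\big)=e^{-\langle\mu,V_t(f)\rangle},\quad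 t>0,$$ for every finite measure $\mu$ and every nonnegative bounded Borel $f$ not a.e. zero. The total mass may become infinite ($e^{-\infty}:=0$). $X$ is a Feller process and has the strong Markov property. Explosion time: $T(f)=T(X_0,f)=\inf\{t\ge 0:\langle X_t,f\rangle\ge n\text{ for all } n\ge 1\}=\inf\{t\ge 0:\langle X_t,f\rangle=\infty\}$ (with $\inf\emptyset=\infty$); $T(1)$ is the case $f\equiv1$. *)

(* Defs.v *)
From HB Require Import structures.
From mathcomp Require Import all_boot all_order all_algebra.
From mathcomp Require Import all_classical all_reals all_analysis.
From mathcomp Require Import measurable_realfun ess_sup_inf.

Set Implicit Arguments.
Unset Strict Implicit.
Unset Printing Implicit Defensive.

Import Order.TTheory GRing.Theory Num.Theory.
Import numFieldNormedType.Exports.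

Local Open Scope classical_set_scope.
Local Open Scope ring_scope.

(* R^d, as tuples: the canonical sigma-algebra on tuples is the product of the
   Borel sigma-algebras, i.e. the Borel sigma-algebra of R^d. *)
Notation euclidean R d := (d.-tuple (measurableTypeR R)).

Section lebesgue_step.
Context (R : realType) (n : nat).
Variable m : {sigma_finite_measure set (euclidean R n) -> \bar R}.

Definition tcons (p : measurableTypeR R * euclidean R n) : euclidean R n.+1 :=
  [tuple of p.1 :: p.2].

Lemma measurable_tcons : measurable_fun [set: _] tcons.
Proof. exact: measurable_cons. Qed.

Definition lebesgue_cons : set (euclidean R n.+1) -> \bar R :=
  pushforward (lebesgue_measure \x m)%E tcons.

HB.instance Definition _ := Measure.copy lebesgue_cons
  (measure_function_pushforward__canonical__measure_function_Measure
     (lebesgue_measure \x m)%E measurable_tcons).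

Lemma sigma_finite_lebesgue_cons : sigma_finite setT lebesgue_cons.
Proof.
have mlast : measurable_fun [set: euclidean R n.+1]
    (fun t => [tuple of behead t]) by exact: measurable_behead.
have mhead : measurable_fun [set: euclidean R n.+1] (fun t => tnth t ord0).
  exact: measurable_tnth.
have /sigma_finiteP[F [TF ndF Foo]] := sigma_finiteT (@lebesgue_measure R).
have /sigma_finiteP[G [TG ndG Goo]] := sigma_finiteT m.
exists (fun k => [set t : euclidean R n.+1 | F k (tnth t ord0)] `&`
                 [set t : euclidean R n.+1 | G k [tuple of behead t]]).
  apply/esym/seteqP; split=> // t _.
  have /seteqP[/(_ (tnth t ord0) I)[i _ Fi] _] := TF.
  have /seteqP[/(_ [tuple of behead t] I)[j _ Gj] _] := TG.
  exists (maxn i j) => //; split.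
    by have /subsetPset := ndF _ _ (leq_maxl i j); exact.
  by have /subsetPset := ndG _ _ (leq_maxr i j); exact.
move=> k; have [mF Fk] := Foo k; have [mG Gk] := Goo k; split.
  by apply: measurableI; rewrite -[X in measurable X]setTI; [exact: mhead|exact: mlast].
rewrite /lebesgue_cons /pushforward (_ : _ @^-1` _ = F k `*` G k).
  by rewrite product_measure1E// lte_mul_pinfty// ge0_fin_numE.
have tconsK (p : measurableTypeR R * euclidean R n) :
  [tuple of behead (tcons p)] = p.2 by exact/val_inj.
by apply/seteqP; split=> p; rewrite /preimage /setX /= -[in G k p.2]tconsK.
Qed.

HB.instance Definition _ :=
  Measure_isSigmaFinite.Build _ _ _ lebesgue_cons sigma_finite_lebesgue_cons.

End lebesgue_step.

(* Lebesgue measure on R^d, as an iterated product measure. *)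
Fixpoint lebesgue (R : realType) (d : nat) :
    {sigma_finite_measure set (euclidean R d) -> \bar R} :=
  match d with
  | 0 => \d_([tuple] : euclidean R 0)
  | d.+1 => lebesgue_cons (lebesgue R d)
  end.

Section log_laplace.
Context (R : realType) (d : nat).
Implicit Types (x y : euclidean R d) (f : euclidean R d -> R).

Definition enorm x : R := Num.sqrt (\sum_(i < d) (tnth x i : R) ^+ 2).

Definition diff x y : euclidean R d := [tuple (tnth x i : R) - tnth y i | i < d].

(* Tuples carry no topology: continuity on R^d is expressed through the
   identification of R^d with row vectors. *)
Definition of_row (u : 'rV[R]_d) : euclidean R d := [tuple u ord0 i | i < d].

(* The class of test functions: nonnegative bounded Borel functions that are
   not Lebesgue-a.e. zero. *)
Definition admissible f : Prop :=
  [/\ measurable_fun [set: _] f, forall x, 0 <= f x,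
      exists M : R, forall x, f x <= M &
      ~ (\forall x \ae lebesgue R d, f x = 0)].

Definition heat_kernel (t : R) x : R :=
  (2 * pi * t) `^ (- (d%:R / 2)) * expR (- (enorm x ^+ 2 / (2 * t))).

Definition heat_semigroup (t : R) f x : \bar R :=
  \int[lebesgue R d]_y (heat_kernel t (diff x y) * f y)%:E.

Definition weight x : R :=
  (fine (\int[lebesgue R d]_y (expR (- enorm y))%:E))^-1 * expR (- enorm x).

(* v is a solution, with initial condition f, of the log-Laplace equation in
   the class where uniqueness holds; only the values v t x with 0 < t matter. *)
Definition log_laplace_solution (gamma : R) f (v : R -> euclidean R d -> R) : Prop :=
  [/\ forall t x, 0 < t -> 0 <= v t x,
      forall t u, 0 < t ->
        {for (t, u), continuous (fun p : R * 'rV[R]_d => v p.1 (of_row p.2))},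
      forall a b : R, 0 < a -> a <= b -> exists M : R,
        \forall t \ae lebesgue_measure, a <= (t : R) <= b ->
          (ess_sup (lebesgue R d) (fun x => `|weight x * v t x|%R%:E) <= M%:E)%E &
      forall t x, 0 < t ->
        ((v t x)%:E = heat_semigroup t f x +
           \int[lebesgue_measure]_(s in `]0%R, t[)
              heat_semigroup (t - s)%R (fun y => (v s y `^ gamma)%R) x)%E].

(* V f t x is V_t(f)(x): for each test function f, V f is the unique solution
   of the log-Laplace equation. *)
Definition log_laplace_semigroup (gamma : R)
    (V : (euclidean R d -> R) -> R -> euclidean R d -> R) : Prop :=
  forall f, admissible f ->
    log_laplace_solution gamma f (V f) /\
    forall v, log_laplace_solution gamma f v ->
      forall t x, 0 < t -> v t x = V f t x.

Definition pairing (mu : {measure set (euclidean R d) -> \bar R}) f : \bar R :=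
  \int[mu]_x (f x)%:E.

End log_laplace.

Section super_brownian_motion.
Context (R : realType) (d : nat) (dO : measure_display).
Context (Omega : measurableType dO) (P : probability Omega R).

Definition filtration (F : R -> set (set Omega)) : Prop :=
  (forall t, 0 <= t -> sigma_algebra setT (F t) /\ F t `<=` measurable) /\
  (forall s t, 0 <= s -> s <= t -> F s `<=` F t).

(* When V is the log-Laplace semigroup of exponent gamma, this says that X is a
   gamma-super-Brownian motion for the filtration F.  The states are arbitrary
   (possibly infinite) measures on R^d.
   - The Markov property with the given Laplace functional reads
       E(exp(-<X_(s+t), f>) | F_s) = exp(-<X_s, V_t f>)   on {<X_s, 1> < oo};
     conditional expectation is spelled out by integrating over the events of
     F_s (the right-hand side is F_s-measurable by adaptedness), and expeR
     sends -oo to 0.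
   - X being a Feller process gives the regularity of its paths: they are a.s.
     right-continuous for the weak topology, extended to infinite measures by
     letting <X_t, phi> range over [0, +oo].  The strong Markov property
     is not imposed as a further condition. *)
Definition super_brownian_motion
    (V : (euclidean R d -> R) -> R -> euclidean R d -> R)
    (F : R -> set (set Omega))
    (X : R -> Omega -> {measure set (euclidean R d) -> \bar R}) : Prop :=
  [/\ filtration F,
      forall (t : R) A (B : set (\bar R)), 0 <= t -> measurable A -> measurable B ->
        F t ((fun w => X t w A) @^-1` B),
      forall s t f A, 0 <= s -> 0 < t -> admissible f -> F s A ->
        A `<=` [set w | X s w setT < +oo]%E ->
        (\int[P]_(w in A) expeR (- pairing (X (s + t)%R w) f) =
         \int[P]_(w in A) expeR (- pairing (X s w) (V f t)))%E &
      \forall w \ae P, forall (phi : euclidean R d -> R) (t : R),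
        (forall x, 0 <= phi x) -> (exists M : R, forall x, phi x <= M) ->
        continuous (phi \o @of_row R d) -> 0 <= t ->
        pairing (X s w) phi @[s --> t^'+] --> pairing (X t w) phi].

(* T(f); the infimum of the empty set is +oo. *)
Definition explosion_time (X : R -> Omega -> {measure set (euclidean R d) -> \bar R})
    (f : euclidean R d -> R) (w : Omega) : \bar R :=
  ereal_inf [set t%:E | t in [set t : R | 0 <= t /\ pairing (X t w) f = +oo%E]].

End super_brownian_motion.

(* Main.v *)
(* Write Y_t = <X_t, 1>, Z_t = <X_t, f>, c(t) = ((1 - gamma) t)^(1 / (1 - gamma)).
   Since gamma < 1, every solution of the log-Laplace equation with nonzero data
   dominates c(t), whatever the size of the data: a first Gaussian lower bound is
   flattened by iterating the integral equation, because v |-> v^gamma divides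
   the exponent of a Gaussian by 1/gamma > 1 while c is a fixed point of the ODE.
   Hence P(Z_t < oo) <= exp(- mu(1) c(t)), and the explicit solution for constant
   data l -> 0 gives equality for Y, so that Y_t = oo <-> Z_t = oo a.s. at each
   fixed t > 0.  For random times, suppose T(1) < q1 < q < T(f).  Then Y is finite
   on a grid of times but, by right-continuity, unbounded on it just after
   T(1); the Markov property at the first grid time where Y >= K bounds the
   probability of {Y reaches [K, oo) before q1, Z_q < oo} by
   exp(- K c(q - q1)), and K -> oo. *)

Require Import Defs.
From HB Require Import structures.
From mathcomp Require Import all_boot all_order all_algebra.
From mathcomp Require Import all_classical all_reals all_analysis.
From mathcomp Require Import measurable_realfun ess_sup_inf ring lra.

Set Implicit Arguments.
Unset Strict Implicit.
Unset Printing Implicit Defensive.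

Import Order.TTheory GRing.Theory Num.Theory.
Import numFieldNormedType.Exports.

Local Open Scope classical_set_scope.
Local Open Scope ring_scope.

(* all_analysis shadows the difference of vectors. *)
Local Notation diff := Defs.diff.

(** * The heat semigroup *)

(** The integral of a nonnegative function is a supremum over simple functions below it, hence
    monotone on arbitrary functions. The source term of the equation is compared this way, without
    measurability of its integrand. *)
Lemma nonneg_integral_mono d (T : measurableType d) (R : realType)
    (mu : {measure set T -> \bar R}) (D E : set T) (f g : T -> \bar R) :
  D `<=` E -> (forall x, D x -> 0 <= f x)%E -> (forall x, E x -> 0 <= g x)%E ->
  (forall x, D x -> f x <= g x)%E ->
  (\int[mu]_(x in D) f x <= \int[mu]_(x in E) g x)%E.
Proof.
move=> DE f0 g0 fg; rewrite !ge0_integralE//.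
apply: le_ereal_sup => _ [h hf <-]; exists h => // x.
rewrite patchE; case: ifPn => [/set_mem|] xE.
- have := hf x; rewrite patchE; case: ifPn => [/set_mem|] xD.
  + by move/le_trans; apply; exact: fg.
  + by move/le_trans; apply; exact: g0.
- have := hf x; rewrite patchE memNset// => /DE /mem_set; exact/negP.
Qed.

Section heat_kernel.
Context (R : realType).

Lemma enorm_sqr d (x : euclidean R d) :
  enorm x ^+ 2 = \sum_(i < d) (tnth x i : R) ^+ 2.
Proof. by rewrite sqr_sqrtr// sumr_ge0// => i _; exact: sqr_ge0. Qed.

Lemma measurable_enorm d : measurable_fun setT (@enorm R d).
Proof.
apply: measurableT_comp => //; first exact: (continuous_measurable_fun (@sqrt_continuous R)).
apply: measurable_sum => i; apply: measurable_funX; exact: measurable_tnth.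
Qed.

Lemma measurable_diff d (x : euclidean R d) : measurable_fun setT (diff x).
Proof.
apply/measurable_fun_tnthP => i.
apply: (eq_measurable_fun (fun y : euclidean R d => (tnth x i : R) - tnth y i)).
  by move=> y _; rewrite /= tnth_mktuple.
by apply: measurable_funB => //; exact: measurable_tnth.
Qed.

Lemma measurable_heat_kernel d (t : R) : measurable_fun setT (@heat_kernel R d t).
Proof.
apply: measurable_funM => //; apply: measurableT_comp => //.
apply: measurableT_comp => //; apply: measurable_funM => //.
by apply: measurable_funX; exact: measurable_enorm.
Qed.

Lemma measurable_heat_kernel_diff d (t : R) (x : euclidean R d) :
  measurable_fun setT (fun y => heat_kernel t (diff x y)).
Proof.
apply: measurableT_comp; first exact: measurable_heat_kernel.
exact: measurable_diff.
Qed.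

Lemma heat_kernel_ge0 d (t : R) (x : euclidean R d) : 0 <= heat_kernel t x.
Proof. by rewrite mulr_ge0 ?powR_ge0 ?expR_ge0. Qed.

(** Gaussian densities split over coordinates; this matches the recursive construction of [lebesgue]
    and drives the induction on the dimension. *)
Lemma heat_kernel_tcons d (t : R) (q p : measurableTypeR R * euclidean R d) :
  0 < t ->
  heat_kernel t (diff (tcons q) (tcons p)) =
  normal_pdf q.1 (Num.sqrt t) p.1 * heat_kernel t (diff q.2 p.2).
Proof.
move=> t0; have st : Num.sqrt t != 0 by rewrite gt_eqF// sqrtr_gt0.
rewrite normal_pdfE// /normal_peak /normal_fun /heat_kernel !enorm_sqr.
rewrite big_ord_recl sqr_sqrtr ?ltW//.
have pt : 0 < 2 * pi * t by rewrite !mulr_gt0 ?pi_gt0.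
have -> : (2 * pi * t) `^ (- (d.+1%:R / 2)) =
    (Num.sqrt (t * pi *+ 2))^-1 * (2 * pi * t) `^ (- (d%:R / 2)).
  have -> : - (d.+1%:R / 2) = - 2^-1 + - (d%:R / 2) :> R.
    by rewrite -addn1 natrD; field.
  rewrite powRD; last by rewrite (gt_eqF pt) implybT.
  rewrite powRN powR12_sqrt ?ltW//; congr ((Num.sqrt _)^-1 * _).
  by ring.
have -> : \sum_(i < d) tnth (diff (tcons q) (tcons p)) (lift ord0 i) ^+ 2 =
    \sum_(i < d) tnth (diff q.2 p.2) i ^+ 2 :> R.
  apply: eq_bigr => i _; rewrite !tnth_mktuple.
  by rewrite /tcons !(tnth_nth 0).
have -> : (tnth (diff (tcons q) (tcons p)) ord0 : R) = q.1 - p.1.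
  by rewrite tnth_mktuple !(tnth_nth 0).
rewrite [(_ + \sum_(i < _) _) / _]mulrDl opprD expRD.
have -> : - ((q.1 - p.1) ^+ 2 / (2 * t)) = - (p.1 - q.1) ^+ 2 / (t *+ 2).
  by rewrite -sqrrN opprB mulNr -[t *+ 2]mulr_natl.
by rewrite -!mulrA; congr (_ * _); rewrite mulrCA.
Qed.

Lemma integral_heat_kernel d (t : R) (x : euclidean R d) : 0 < t ->
  (\int[lebesgue R d]_y (heat_kernel t (diff x y))%:E = 1)%E.
Proof.
move=> t0; elim: d x => [x|d IH x].
  rewrite integral_dirac//=; last first.
    by apply/measurable_EFinP; exact: measurable_heat_kernel_diff.
  rewrite diracT mul1e /heat_kernel enorm_sqr big_ord0.
  by rewrite !mul0r !oppr0 powRr0 expR0 mulr1.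
rewrite [LHS](ge0_integral_pushforward (@measurable_tcons R d))//; first last.
- by move=> y _; rewrite lee_fin heat_kernel_ge0.
- by apply/measurable_EFinP; exact: measurable_heat_kernel_diff.
rewrite preimage_setT fubini_tonelli1/=; first last.
- by move=> y; rewrite lee_fin heat_kernel_ge0.
- apply/measurable_EFinP/measurableT_comp; first exact: measurable_heat_kernel.
  by apply: measurableT_comp; [exact: measurable_diff|exact: measurable_tcons].
have -> : x = tcons (thead x, [tuple of behead x]) by exact: tuple_eta.
rewrite -(integral_normal_pdf (thead x) (Num.sqrt t)).
apply: eq_integral => a _; rewrite /fubini_F/=.
under eq_integral do rewrite heat_kernel_tcons// EFinM/=.
rewrite ge0_integralZl//; first by rewrite IH mule1.
- by apply/measurable_EFinP; exact: measurable_heat_kernel_diff.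
- by move=> y _; rewrite lee_fin heat_kernel_ge0.
- by rewrite lee_fin normal_pdf_ge0.
Qed.

End heat_kernel.

(** * The equation u' = u ^ gamma *)

Section affine_powR.
Context (R : realType) (p c : R) (p0 : 0 < p) (c0 : 0 < c).
Local Notation h a := (fun s : R => (a + c * s) `^ p).

Lemma le_affine_powR (a s t : R) : 0 <= a + c * s -> s <= t -> h a s <= h a t.
Proof.
move=> as0 st; have le_ast : a + c * s <= a + c * t by rewrite lerD2l ler_pM2l.
by apply: ge0_ler_powR; rewrite ?(ltW p0)// ?nnegrE//; exact: le_trans le_ast.
Qed.

Lemma is_derive_affine_powR (a s : R) : 0 < a + c * s ->
  is_derive s 1 (h a) (p * c * (a + c * s) `^ (p - 1)).
Proof.
move=> as0; have k : is_derive s 1 (fun s : R => a + c * s) c.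
  have := is_deriveD (is_derive_cst a s 1) (is_deriveZ c (is_derive_id s (1 : R))).
  by rewrite add0r [_ *: _]mulr1; exact.
have := @is_derive1_comp R (@powR R ^~ p) (fun s => a + c * s) _ _ _ (@is_derive1_powR R p _ as0) k.
by rewrite mulrAC.
Qed.

Lemma continuous_affine_powR (a s : R) : 0 < a + c * s ->
  {for s, continuous (h a)}.
Proof.
move=> /is_derive_affine_powR[ds _].
by apply: differentiable_continuous; exact/derivable1_diffP.
Qed.

Lemma affine_powR_cvg_at_right (a e : R) : 0 <= a + c * e ->
  h a s @[s --> e^'+] --> h a e.
Proof.
rewrite le_eqVlt => /predU1P[ae|ae]; last first.
  exact/cvg_at_right_filter/continuous_affine_powR.
rewrite -ae powR0 ?gt_eqF//; apply/cvgrPdist_le => /= x x0.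
(* The base vanishes at [e]; at this distance to the right of [e] the power reaches exactly [x]. *)
have r0 : 0 < x `^ p^-1 / c by rewrite divr_gt0// powR_gt0.
near=> s; rewrite sub0r normrN ger0_norm ?powR_ge0//.
have -> : x = h a (e + x `^ p^-1 / c).
  rewrite mulrDr addrA -ae add0r mulrCA divff ?gt_eqF// mulr1 -powRrM.
  by rewrite mulVf ?gt_eqF// powRr1// ltW.
have es : e <= s by [].
apply: le_affine_powR; first by rewrite ae lerD2l ler_pM2l.
near: s; apply: nbhs_right_le.
by rewrite ltrDl.
Unshelve. all: by end_near. Qed.

Lemma within_continuous_affine_powR (a e t : R) : 0 <= a + c * e -> e < t ->
  {within `[e, t], continuous (h a)}.
Proof.
move=> ae et; have pos s : e < s -> 0 < a + c * s.
  by move=> es; apply: (le_lt_trans ae); rewrite ltrD2l ltr_pM2l.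
apply/(continuous_within_itvP _ et); split.
- by move=> s /[!in_itv]/= /andP[/pos as0 _]; exact: continuous_affine_powR.
- exact: affine_powR_cvg_at_right.
- exact/cvg_at_left_filter/continuous_affine_powR/pos.
Qed.

End affine_powR.

Section flow.
Context (R : realType).

(* [flow g a] is the solution of u' = u `^ g with u(0) = a `^ (1 - g)^-1. *)
Definition flow (g a s : R) : R := (a + (1 - g) * s) `^ (1 - g)^-1.

Context (g : R) (g01 : 0 < g < 1).

Let g1 : 0 < 1 - g. Proof. by rewrite subr_gt0; case/andP: g01. Qed.

Lemma flow_ge0 a s : 0 <= flow g a s.
Proof. exact: powR_ge0. Qed.

Lemma flow_gt0 s : 0 < s -> 0 < flow g 0 s.
Proof. by move=> s0; rewrite powR_gt0// add0r mulr_gt0. Qed.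

Let q0 : 0 < (1 - g)^-1. Proof. by rewrite invr_gt0. Qed.

Lemma le_flow a s t : 0 <= a -> 0 <= s -> s <= t -> flow g a s <= flow g a t.
Proof.
move=> a0 s0 st; apply: le_affine_powR => //.
by rewrite addr_ge0// mulr_ge0// ltW.
Qed.

Lemma flow_powR a s : flow g a s `^ g = (a + (1 - g) * s) `^ ((1 - g)^-1 - 1).
Proof.
rewrite -powRrM; congr (_ `^ _).
by field; rewrite gt_eqF.
Qed.

Lemma is_derive_flow a s : 0 < a + (1 - g) * s ->
  is_derive s 1 (flow g a) (flow g a s `^ g).
Proof.
move=> as0; have := is_derive_affine_powR (1 - g)^-1 as0.
by rewrite mulVf ?gt_eqF// mul1r flow_powR.
Qed.

(** The base may vanish at [e]: the flow then leaves 0 at that time. This nonzero solution with zero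
    initial value is the one used in the lower bounds. *)
Lemma integral_flow a e t : 0 <= a + (1 - g) * e -> e < t ->
  (\int[lebesgue_measure]_(s in `]e, t[) (flow g a s `^ g)%:E =
   (flow g a t - flow g a e)%:E)%E.
Proof.
move=> ae et.
have pos s : e < s -> 0 < a + (1 - g) * s.
  by move=> es; apply: (le_lt_trans ae); rewrite ltrD2l ltr_pM2l.
have LR : derivable_oo_LRcontinuous (flow g a) e t.
  split; last 2 first.
  - exact: affine_powR_cvg_at_right.
  - exact/cvg_at_left_filter/continuous_affine_powR/pos.
  by move=> s /[!in_itv]/= /andP[/pos as0 _]; case: (is_derive_flow as0).
(* The exponent g / (1 - g) is positive, so the derivative stays continuous where the flow
   vanishes. *)
have q10 : 0 < (1 - g)^-1 - 1.
  rewrite subr_gt0 invf_gt1//; case/andP: g01 => ? _.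
  by rewrite ltrBlDr ltrDl.
have cf : {within `[e, t], continuous (fun s => flow g a s `^ g)}.
  rewrite (_ : (fun s => _) = fun s => (a + (1 - g) * s) `^ ((1 - g)^-1 - 1)).
    exact: within_continuous_affine_powR.
  by apply/funext => s; rewrite flow_powR.
rewrite -(@integral_itv_bndoo _ _ _ _ true false); last first.
  apply/measurable_funTS/measurable_EFinP.
  apply: (measurableT_comp (measurable_powR g)).
  apply: (measurableT_comp (measurable_powR _)).
  by apply: measurable_funD => //; exact: measurable_funM.
rewrite (continuous_FTC2 et cf LR)// => s /[!in_itv]/= /andP[/pos as0 _].
by rewrite derive1E; case: (is_derive_flow as0).
Qed.

End flow.

(** * Solutions of the log-Laplace equation *)

Section gaussian_lower_bound.
Context (R : realType) (d : nat).
Implicit Types (x y : euclidean R d) (r b T : R).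

(* Completing the square turns the product with a Gaussian into a heat kernel
   of smaller variance. *)
Lemma heat_kernel_mul_gauss r b T x y : 0 < r <= T -> 0 <= b ->
  expR (- (b * (d%:R * T + enorm x ^+ 2))) *
    heat_kernel (r / (1 + 2 * b * r))
      (diff [tuple (tnth x i : R) / (1 + 2 * b * r) | i < d] y) <=
  heat_kernel r (diff x y) * expR (- (b * enorm y ^+ 2)).
Proof.
move=> /andP[r0 rT] b0; set k := 1 + 2 * b * r.
have k1 : 1 <= k by rewrite lerDl !mulr_ge0// ltW.
have k0 : 0 < k by exact: lt_le_trans k1.
have sq : enorm (diff x y) ^+ 2 / (2 * r) + b * enorm y ^+ 2 =
    enorm (diff [tuple (tnth x i : R) / k | i < d] y) ^+ 2 / (2 * (r / k)) +
    b * (enorm x ^+ 2 / k).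
  rewrite !enorm_sqr !mulr_suml !mulr_sumr -!big_split/=.
  apply: eq_bigr => i _; rewrite !tnth_mktuple /k; field.
  by rewrite !gt_eqF//= pnatr_eq0.
have pr : 2 * pi * r = k * (2 * pi * (r / k)) by field; rewrite gt_eqF.
(* The normalising factors of the two kernels differ by [k] to the power -d/2; ln (1 + 2 b r) <= 2 b
   T turns this into the loss d T in the exponent. *)
have pk : expR (- (b * (d%:R * T))) <= k `^ (- (d%:R / 2)).
  rewrite /powR gt_eqF// ler_expR mulNr lerN2.
  have lk : ln k <= 2 * b * T.
    apply: (@le_trans _ _ (2 * b * r)); last by rewrite ler_wpM2l// mulr_ge0.
    by apply: le_ln1Dx; rewrite (lt_le_trans (ltrN10 _))// !mulr_ge0// ltW.
  have -> : b * (d%:R * T) = d%:R / 2 * (2 * b * T) by field.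
  by rewrite ler_wpM2l// divr_ge0.
rewrite {2}/heat_kernel -[leRHS]mulrA -expRD -opprD sq opprD expRD.
rewrite pr powRM ?(ltW k0) ?mulr_ge0 ?pi_ge0 ?invr_ge0 ?(ltW k0) ?(ltW r0)//.
rewrite [leRHS](_ : _ = k `^ (- (d%:R / 2)) * expR (- (b * (enorm x ^+ 2 / k))) *
  heat_kernel (r / k) (diff [tuple (tnth x i : R) / k | i < d] y)); last first.
  by rewrite /heat_kernel; ring.
rewrite ler_wpM2r ?heat_kernel_ge0// mulrDr opprD expRD ler_pM ?expR_ge0//.
by rewrite ler_expR lerN2 ler_wpM2l// ler_pdivrMr// ler_peMr// sqr_ge0.
Qed.

(** The kernel of reduced variance has total mass 1, so the coefficient [b] survives and only d T is
    lost. *)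
Lemma heat_semigroup_ge_gauss r b T (C : R) (h : euclidean R d -> R) x :
  0 < r <= T -> 0 <= b -> 0 <= C ->
  (forall y, C * expR (- (b * enorm y ^+ 2)) <= h y) ->
  ((C * expR (- (b * (d%:R * T + enorm x ^+ 2))))%:E <= heat_semigroup r h x)%E.
Proof.
move=> /[dup] rT /andP[r0 _] b0 C0 hC.
set k := 1 + 2 * b * r; have k0 : 0 < k by rewrite ltr_wpDr// !mulr_ge0// ltW.
set z := [tuple (tnth x i : R) / k | i < d].
set E := C * expR _; have E0 : 0 <= E by rewrite mulr_ge0// expR_ge0.
rewrite -[leLHS]mule1 -(@integral_heat_kernel R d (r / k) z) ?divr_gt0//.
rewrite -ge0_integralZl//; last 2 first.
- by apply/measurable_EFinP; exact: measurable_heat_kernel_diff.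
- by move=> y _; rewrite lee_fin heat_kernel_ge0.
apply: nonneg_integral_mono => // y _; rewrite -?EFinM lee_fin.
- by rewrite mulr_ge0 ?heat_kernel_ge0.
- by rewrite mulr_ge0 ?heat_kernel_ge0// (le_trans _ (hC y))// mulr_ge0 ?expR_ge0.
apply: (le_trans _ (ler_wpM2l (heat_kernel_ge0 _ _) (hC y))).
rewrite [leRHS]mulrCA -[leLHS]mulrA ler_wpM2l//.
exact: heat_kernel_mul_gauss.
Qed.

(** Since |x - y|^2 <= 2 (|x|^2 + |y|^2), a product separating [x] from [y] bounds the kernel from
    below, uniformly over times in [e, T]. *)
Lemma heat_kernel_ge_gauss r e T x y : 0 < e -> e <= r <= T ->
  (2 * pi * T) `^ (- (d%:R / 2)) *
    expR (- (enorm x ^+ 2 / e)) * expR (- (enorm y ^+ 2 / e)) <=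
  heat_kernel r (diff x y).
Proof.
move=> e0 /andP[er rT]; have r0 : 0 < r := lt_le_trans e0 er.
have T0 : 0 < T := lt_le_trans r0 rT.
rewrite /heat_kernel -mulrA -expRD ler_pM ?powR_ge0 ?expR_ge0//.
  rewrite !powRN lef_pV2 ?posrE ?powR_gt0 ?mulr_gt0 ?pi_gt0//.
  apply: ge0_ler_powR; rewrite ?nnegrE ?mulr_ge0 ?pi_ge0 ?(ltW r0) ?(ltW T0)//.
  by rewrite ler_wpM2l// mulr_ge0// pi_ge0.
rewrite ler_expR -opprD lerN2 -mulrDl.
have le_sq : enorm (diff x y) ^+ 2 <= 2 * (enorm x ^+ 2 + enorm y ^+ 2).
  rewrite !enorm_sqr -big_split/= mulr_sumr ler_sum// => i _.
  rewrite tnth_mktuple -subr_ge0.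
  by rewrite (_ : _ - _ = (tnth x i + tnth y i) ^+ 2) ?sqr_ge0//; ring.
rewrite ler_pdivrMr ?mulr_gt0//; apply: (le_trans le_sq).
rewrite mulrC -mulrA ler_wpM2l ?addr_ge0 ?sqr_ge0//.
by rewrite mulrCA ler_peMr// mulrC ler_pdivlMr// mul1r.
Qed.

End gaussian_lower_bound.

(** * Lower bound by the flow, uniform in the initial data *)

Section solution_lower_bound.
Context (R : realType) (d : nat) (g : R) (g01 : 0 < g < 1).
Context (f : euclidean R d -> R) (v : R -> euclidean R d -> R).
Hypothesis f_adm : admissible f.
Hypothesis sol : log_laplace_solution g f v.

Let g0 : 0 < g. Proof. by case/andP: g01. Qed.
Let g1 : 0 < 1 - g. Proof. by rewrite subr_gt0; case/andP: g01. Qed.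
Let f0 x : 0 <= f x. Proof. by case: f_adm. Qed.
Let v0 t x : 0 < t -> 0 <= v t x. Proof. by case: sol => + _ _ _; apply. Qed.

Let semigroup_ge0 r (h : euclidean R d -> R) x : (forall y, 0 <= h y) ->
  (0 <= heat_semigroup r h x)%E.
Proof.
by move=> h0; apply: integral_ge0 => y _; rewrite lee_fin mulr_ge0// heat_kernel_ge0.
Qed.

Let source_ge0 t x :
  (0 <= \int[lebesgue_measure]_(s in `]0%R, t[)
     heat_semigroup (t - s)%R (fun y => (v s y `^ g)%R) x)%E.
Proof.
apply: integral_ge0 => s _; apply: semigroup_ge0 => y; exact: powR_ge0.
Qed.

Lemma integral_gauss_admissible_gt0 (e : R) :
  (0 < \int[lebesgue R d]_y (expR (- (enorm y ^+ 2 / e)) * f y)%:E)%E.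
Proof.
have ge0 y : (0 <= (expR (- (enorm y ^+ 2 / e)) * f y)%:E)%E.
  by rewrite lee_fin mulr_ge0 ?expR_ge0.
rewrite lt0e integral_ge0// andbT; apply/eqP => int0.
case: f_adm => mf _ _; apply.
have mh : measurable_fun setT (fun y => (expR (- (enorm y ^+ 2 / e)) * f y)%:E).
  apply/measurable_EFinP; apply: measurable_funM => //.
  apply: measurableT_comp => //; apply: measurableT_comp => //.
  by apply: measurable_funM => //; apply: measurable_funX; exact: measurable_enorm.
have := (ae_eq_integral_abs (lebesgue R d) measurableT mh).1.
under eq_integral do rewrite gee0_abs//.
move=> /(_ int0); apply: filterS => y /(_ I)[] /eqP.
by rewrite mulf_eq0 gt_eqF ?expR_gt0//= => /eqP.
Qed.

(** Dropping the source term leaves the heat flow of [f], and the separated kernel bound factors a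
    Gaussian in [x] out of it. *)
Lemma solution_ge_gauss (e T : R) : 0 < e -> e < T ->
  exists2 j : R, 0 < j & forall s x, e < s -> s <= T ->
    j * expR (- (enorm x ^+ 2 / e)) <= v s x.
Proof.
move=> e0 eT; have T0 := lt_trans e0 eT.
set K := (2 * pi * T) `^ (- (d%:R / 2)).
have K0 : 0 < K by rewrite powR_gt0// !mulr_gt0 ?pi_gt0.
set J := (\int[lebesgue R d]_y (expR (- (enorm y ^+ 2 / e)) * f y)%:E)%E.
have J0 : (0 < J)%E := integral_gauss_admissible_gt0 e.
have main s x : e < s -> s <= T ->
    ((K * expR (- (enorm x ^+ 2 / e)))%:E * J <= (v s x)%:E)%E.
  move=> es sT; have s0 := lt_trans e0 es.
  case: sol => _ _ _ /(_ s x s0) ->.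
  apply: (le_trans _ (leeDl _ (source_ge0 s x))).
  rewrite /J -ge0_integralZl//; last 3 first.
  - apply/measurable_EFinP; apply: measurable_funM; last by case: f_adm.
    apply: measurableT_comp => //; apply: measurableT_comp => //.
    by apply: measurable_funM => //; apply: measurable_funX; exact: measurable_enorm.
  - by move=> y _; rewrite lee_fin mulr_ge0 ?expR_ge0.
  - by rewrite lee_fin mulr_ge0 ?expR_ge0 ?ltW.
  apply: nonneg_integral_mono => // y _; rewrite -?EFinM lee_fin.
  - by rewrite !mulr_ge0 ?expR_ge0 ?(ltW K0).
  - by rewrite mulr_ge0 ?heat_kernel_ge0.
  - by rewrite mulrA ler_wpM2r//; apply: heat_kernel_ge_gauss; rewrite ?(ltW es).
(* [v] is real-valued, so the bound at time [T] and at the origin forces [J] to be finite. *)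
have Jfin : J \is a fin_num.
  rewrite ge0_fin_numE ?(ltW J0)//; rewrite ltNge leye_eq; apply/eqP => Joo.
  have := main T [tuple 0 | i < d] eT (lexx _).
  by rewrite Joo gt0_muley ?lte_fin ?mulr_gt0 ?expR_gt0// leye_eq.
exists (K * fine J) => [|s x es sT]; first by rewrite mulr_gt0// fine_gt0// J0 ltey_eq Jfin.
by have := main s x es sT; rewrite -(fineK Jfin) -EFinM lee_fin mulrAC.
Qed.

(* Raising to the power [g] flattens the Gaussian factor by [g], up to the loss
   [d T] due to the heat flow, which the constant [W] absorbs at the price of
   replacing [g] by [h]; the factor [flow] is reproduced exactly. *)
Lemma solution_ge_flow_step (e T W h M : R) : 0 < e -> 0 <= M ->
  g <= h -> g * (W + d%:R * T) <= h * W ->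
  (forall s x, e < s -> s <= T ->
    flow g (- (1 - g) * e) s * expR (- (M * (W + enorm x ^+ 2))) <= v s x) ->
  forall s x, e < s -> s <= T ->
    flow g (- (1 - g) * e) s * expR (- (h * M * (W + enorm x ^+ 2))) <= v s x.
Proof.
move=> e0 M0 gh gW IH t x et tT.
(* With this [a] the flow starts from 0 at time [e]. *)
set a := - (1 - g) * e.
have ae : 0 <= a + (1 - g) * e by rewrite /a mulNr addrC subrr.
set E := expR (- (h * M * (W + enorm x ^+ 2))).
have t0 := lt_trans e0 et.
rewrite -lee_fin; case: sol => _ _ _ /(_ t x t0) ->.
apply: (le_trans _ (leeDr _ (semigroup_ge0 _ _ f0))).
have flow_e : flow g a e = 0.
  by rewrite /flow /a mulNr addrC subrr powR0// invr_eq0 gt_eqF.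
have -> : (flow g a t * E)%:E = (\int[lebesgue_measure]_(s in `]e, t[)
    (E%:E * (flow g a s `^ g)%:E))%E.
  rewrite ge0_integralZl//.
  - by rewrite integral_flow// flow_e subr0 -EFinM mulrC.
  - apply/measurable_EFinP; apply/measurable_funTS.
    apply: (measurableT_comp (measurable_powR g)).
    apply: (measurableT_comp (measurable_powR _)).
    by apply: measurable_funD => //; exact: measurable_funM.
  - by move=> s _; rewrite lee_fin powR_ge0.
  - by rewrite lee_fin expR_ge0.
apply: nonneg_integral_mono.
- by apply: subset_itvr; rewrite bnd_simp ltW.
- by move=> s _; rewrite -EFinM lee_fin mulr_ge0 ?expR_ge0 ?powR_ge0.
- by move=> s _; apply: semigroup_ge0 => y; exact: powR_ge0.
move=> s /=; rewrite in_itv/= => /andP[es st].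
(* [C] collects what does not depend on [y] in the lower bound for v^g at time [s]. *)
pose C := flow g a s `^ g * expR (- (g * M * W)).
have C0 : 0 <= C by rewrite mulr_ge0 ?powR_ge0 ?expR_ge0.
apply: (@le_trans _ _ (C * expR (- (g * M * (d%:R * T + enorm x ^+ 2))))%:E).
  rewrite -EFinM lee_fin mulrC /C -mulrA -expRD ler_wpM2l ?powR_ge0//.
  rewrite ler_expR -opprD lerN2 -mulrDr mulrAC -[leRHS]mulrAC ler_wpM2r//.
  rewrite addrA !mulrDr lerD//; last by rewrite ler_wpM2r// sqr_ge0.
  by rewrite -mulrDr.
apply: heat_semigroup_ge_gauss => //.
- rewrite subr_gt0 st/= lerBlDr (le_trans tT)// lerDl.
  by rewrite ltW// (lt_trans e0).
- by rewrite mulr_ge0// ltW.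
move=> y; rewrite /C -mulrA -expRD.
have -> : - (g * M * W) + - (g * M * enorm y ^+ 2) =
    - (M * (W + enorm y ^+ 2)) * g by ring.
rewrite expRM -powRM ?expR_ge0 ?flow_ge0//.
apply: ge0_ler_powR; rewrite ?nnegrE ?(ltW g0)//.
- by rewrite mulr_ge0 ?expR_ge0 ?flow_ge0.
- by rewrite v0// (lt_trans e0).
- by rewrite IH// (le_trans (ltW st)).
Qed.

(** The flow restarted from 0 at time [e] is handled first: each iteration multiplies the Gaussian
    exponent by [h < 1], so the Gaussian factor tends to 1. Then [e] tends to 0. *)
Lemma solution_ge_flow t x : 0 < t -> flow g 0 t <= v t x.
Proof.
move=> t0.
have shifted e : 0 < e -> e < t -> flow g (- (1 - g) * e) t <= v t x.
  move=> e0 et; have [j j0 vj] := solution_ge_gauss e0 et.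
  pose h := (1 + g) / 2.
  have gh : g < h by rewrite /h; case/andP: g01 => *; lra.
  have h1 : h < 1 by rewrite /h; case/andP: g01 => *; lra.
  have h0 : 0 < h := lt_trans g0 gh.
  (* This solves g (W + d t) <= h W for [W]; the added 1 keeps [W] positive. *)
  pose W := g * (d%:R * t) / (h - g) + 1.
  have W0 : 0 < W by rewrite ltr_wpDl// divr_ge0 ?subr_ge0 ?(ltW gh)// !mulr_ge0 ?(ltW g0) ?(ltW t0).
  have gW : g * (W + d%:R * t) <= h * W.
    have hg0 : h - g != 0 by rewrite gt_eqF// subr_gt0.
    rewrite -subr_ge0.
    rewrite (_ : _ - _ = h - g); first by rewrite subr_ge0 ltW.
    by rewrite /W; field.
  pose F := flow g 0 t.
  have F0 : 0 < F by exact: flow_gt0.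
  (* The term 1 / e makes the Gaussian at least as steep as that of the first bound; the other term
     gives exp (M W) >= 1 + M W >= F / j. *)
  pose M := e^-1 + F / (j * W).
  have M0 : 0 <= M by rewrite addr_ge0 ?invr_ge0 ?divr_ge0 ?mulr_ge0 ?(ltW e0) ?(ltW F0) ?(ltW j0) ?(ltW W0).
  have base s y : e < s -> s <= t ->
      flow g (- (1 - g) * e) s * expR (- (M * (W + enorm y ^+ 2))) <= v s y.
    move=> es st; apply: (le_trans _ (vj s y es st)).
    have s0 := lt_trans e0 es.
    have fF : flow g (- (1 - g) * e) s <= F.
      have -> : flow g (- (1 - g) * e) s = flow g 0 (s - e).
        by rewrite /flow; congr (_ `^ _); ring.
      apply: le_flow => //; first by rewrite subr_ge0 ltW.
      by rewrite lerBlDr (le_trans st)// lerDl ltW.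
    rewrite (_ : - (M * _) = - (M * W) + - (M * enorm y ^+ 2)); last by ring.
    rewrite expRD mulrA ler_pM ?mulr_ge0 ?flow_ge0 ?expR_ge0//.
      apply: (le_trans (ler_wpM2r (expR_ge0 _) fF)).
      rewrite expRN ler_pdivrMr ?expR_gt0// mulrC -ler_pdivrMr//.
      apply: le_trans (expR_ge1Dx _); rewrite /M mulrDl.
      have -> : F / (j * W) * W = F / j by field; rewrite !gt_eqF.
      by rewrite addrA lerDr// addr_ge0// mulr_ge0 ?invr_ge0 ?ltW.
    rewrite ler_expR lerN2 mulrC ler_wpM2r ?sqr_ge0// /M lerDl.
    by rewrite divr_ge0 ?mulr_ge0 ?ltW.
  have iterated n s y : e < s -> s <= t ->
      flow g (- (1 - g) * e) s * expR (- (h ^+ n * M * (W + enorm y ^+ 2))) <= v s y.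
    elim: n s y => [|n IHn] s y; first by rewrite mul1r; exact: base.
    rewrite exprS -(mulrA h); apply: solution_ge_flow_step => //.
    - by rewrite mulr_ge0// exprn_ge0// ltW.
    - exact: ltW.
  have hn0 : (fun n => - (h ^+ n * M * (W + enorm x ^+ 2))) @ \oo --> (0 : R).
    rewrite -oppr0 -(mul0r (W + enorm x ^+ 2)) -(mul0r M).
    apply: cvgN; apply: cvgM; last exact: cvg_cst.
    by apply: cvgM; [apply: cvg_expr; rewrite ger0_norm ?ltW|exact: cvg_cst].
  have : (fun n => flow g (- (1 - g) * e) t * expR (- (h ^+ n * M * (W + enorm x ^+ 2)))) @ \oo
      --> flow g (- (1 - g) * e) t * expR 0.
    apply: cvgM; first exact: cvg_cst.
    by apply: continuous_cvg => //; exact: continuous_expR.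
  rewrite expR0 mulr1 => /cvgr_to_le; apply.
  by apply: nearW => n; exact: iterated.
have : flow g 0 (t - e) @[e --> (0 : R)^'+] --> flow g 0 t.
  apply: cvg_at_right_filter.
  have c : {for t - 0, continuous (flow g 0)}.
    by apply: continuous_affine_powR; rewrite subr0 add0r mulr_gt0.
  rewrite -[X in _ --> flow g 0 X]subr0; apply: continuous_cvg => //.
  by apply: cvgB; [exact: cvg_cst|exact: cvg_id].
move=> /cvgr_to_le; apply; near=> e.
have -> : flow g 0 (t - e) = flow g (- (1 - g) * e) t.
  by rewrite /flow; congr (_ `^ _); ring.
by apply: shifted => //; near: e; exact: nbhs_right_lt.
Unshelve. all: by end_near. Qed.

End solution_lower_bound.

(** * Explicit solutions for constant data *)

Section constant_data.
Context (R : realType) (d : nat).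

Lemma heat_semigroup_cst (t c : R) (x : euclidean R d) : 0 < t -> 0 <= c ->
  heat_semigroup t (fun=> c) x = c%:E.
Proof.
move=> t0 c0; rewrite /heat_semigroup.
under eq_integral do rewrite EFinM.
rewrite ge0_integralZr//.
- by rewrite integral_heat_kernel// mul1e.
- by apply/measurable_EFinP; exact: measurable_heat_kernel_diff.
- by move=> y _; rewrite lee_fin heat_kernel_ge0.
Qed.

(** The heat semigroup fixes constants, so the equation reduces to u' = u^g; the parameter l^(1 - g)
    encodes u(0) = l. Uniqueness will then make [V] explicit on constants. *)
Lemma log_laplace_solution_flow (g l : R) : 0 < g < 1 -> 0 < l ->
  log_laplace_solution g (fun=> l : R)
    (fun t (_ : euclidean R d) => flow g (l `^ (1 - g)) t).
Proof.
move=> g01 l0; have g1 : 0 < 1 - g by rewrite subr_gt0; case/andP: g01.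
have a0 : 0 < l `^ (1 - g) := powR_gt0 _ l0.
have base s : 0 <= s -> 0 < l `^ (1 - g) + (1 - g) * s.
  by move=> s0; rewrite ltr_wpDr// mulr_ge0// ltW.
split.
- by move=> t x _; exact: flow_ge0.
- move=> t u t0; apply: (@continuous_comp _ _ _ fst (flow g (l `^ (1 - g)))).
    exact: cvg_fst.
  exact/continuous_affine_powR/base/ltW.
- move=> a b a0' ab.
  pose C := (fine (\int[lebesgue R d]_y (expR (- enorm y))%:E))^-1.
  have C0 : 0 <= C.
    by rewrite invr_ge0 fine_ge0// integral_ge0// => y _; rewrite lee_fin expR_ge0.
  exists (C * flow g (l `^ (1 - g)) b); apply: aeW => t /andP[at_ tb].
  apply/ess_supP; apply: aeW => x; rewrite lee_fin ger0_norm; last first.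
    by rewrite !mulr_ge0 ?expR_ge0 ?flow_ge0.
  rewrite ler_pM ?flow_ge0//.
  + by rewrite mulr_ge0 ?expR_ge0.
  + by rewrite /weight -/C ler_piMr// -[leRHS]expR0 ler_expR oppr_le0 sqrtr_ge0.
  + by apply: le_flow; rewrite ?(ltW a0)// (le_trans (ltW a0')).
- move=> t x t0; rewrite heat_semigroup_cst ?(ltW l0)//.
  rewrite [X in (_ + X)%E](_ : _ = \int[lebesgue_measure]_(s in `]0%R, t[)
      (flow g (l `^ (1 - g)) s `^ g)%:E)%E; last first.
    apply: eq_integral => s; rewrite inE/= in_itv/= => /andP[s0 st].
    by rewrite heat_semigroup_cst ?subr_gt0// powR_ge0.
  rewrite integral_flow//; last by rewrite ltW// base.
  rewrite -EFinD; congr EFin.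
  have -> : flow g (l `^ (1 - g)) 0 = l.
    by rewrite /flow mulr0 addr0 -powRrM divff ?gt_eqF// powRr1 ?(ltW l0).
  by rewrite (addrC l) subrK.
Qed.

Context (f : euclidean R d -> R) (f_adm : admissible f).

(** If a positive constant vanished a.e., every function would; the admissible [f] excludes this. *)
Lemma admissible_cst (l : R) : 0 < l -> admissible (fun _ : euclidean R d => l).
Proof.
move=> l0; split=> //; first by move=> _; exact: ltW.
  by exists l.
case: f_adm => _ _ _ nf ae0; apply: nf; apply: filterS ae0 => x l00.
by move: l0; rewrite l00 ltxx.
Qed.

Lemma admissible_scale (l : R) : 0 < l -> admissible (fun x => l * f x).
Proof.
move=> l0; case: f_adm => mf f0 [M fM] nf; split.
- exact: measurable_funM.
- by move=> x; rewrite mulr_ge0// ltW.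
- by exists (l * M) => x; rewrite ler_pM2l.
- move=> ae0; apply: nf; apply: filterS ae0 => x /eqP.
  by rewrite mulf_eq0 gt_eqF//= => /eqP.
Qed.

Lemma flow_cvg_initial (g t : R) : 0 < g < 1 -> 0 < t ->
  flow g (l `^ (1 - g)) t @[l --> 0^'+] --> flow g 0 t.
Proof.
move=> g01 t0; have g1 : 0 < 1 - g by rewrite subr_gt0; case/andP: g01.
have c : {for 0 + (1 - g) * t, continuous (@powR R ^~ (1 - g)^-1)}.
  apply: differentiable_continuous; apply/derivable1_diffP/derivable_powR.
  by rewrite in_itv/= andbT add0r mulr_gt0.
apply: (@continuous_cvg _ _ _ _ _ _ (@powR R ^~ (1 - g)^-1)) => //.
by apply: cvgD; [exact: powR_cvg0|exact: cvg_cst].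
Qed.

End constant_data.

(** * Explosion of the super-Brownian motion *)

Lemma le_measure_bigcup d (T : measurableType d) (R : realType)
    (mu : {measure set T -> \bar R}) (B : nat -> set T) (q : \bar R) :
  (forall n, measurable (B n)) -> (forall n, B n `<=` B n.+1) ->
  (forall n, mu (B n) <= q)%E -> (mu (\bigcup_n B n) <= q)%E.
Proof.
move=> mB ndB Bq.
have : (mu \o B) x @[x --> \oo] --> mu (\bigcup_n B n).
  apply: nondecreasing_cvg_mu => //; first exact: bigcup_measurable.
  by apply/nondecreasing_seqP => n; exact/subsetPset.
by move=> /cvge_to_le; apply; exact: nearW.
Qed.

Section pairing.
Context (R : realType) (d : nat).
Implicit Types (m : {measure set (euclidean R d) -> \bar R}).

Lemma pairing_cst m (l : R) : pairing m (fun=> l) = (l%:E * m setT)%E.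
Proof. by rewrite /pairing -integral_cst. Qed.

Lemma pairing_ge m (l : R) (h : euclidean R d -> R) : 0 <= l ->
  (forall x, l <= h x) -> (l%:E * m setT <= pairing m h)%E.
Proof.
move=> l0 lh; rewrite -pairing_cst; apply: nonneg_integral_mono => // x _.
  by rewrite lee_fin (le_trans l0).
by rewrite lee_fin.
Qed.

Lemma pairing_le m (l : R) (h : euclidean R d -> R) : (forall x, 0 <= h x) ->
  (forall x, h x <= l) -> (pairing m h <= l%:E * m setT)%E.
Proof.
move=> h0 hl; rewrite -pairing_cst; apply: nonneg_integral_mono => // x _.
- by rewrite lee_fin.
- by rewrite lee_fin (le_trans (h0 x)).
- by rewrite lee_fin.
Qed.

Lemma pairing_scale m (l : R) (h : euclidean R d -> R) : 0 <= l ->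
  measurable_fun setT h -> (forall x, 0 <= h x) ->
  pairing m (fun x => l * h x) = (l%:E * pairing m h)%E.
Proof.
move=> l0 mh h0; rewrite /pairing; under eq_integral do rewrite EFinM.
by rewrite ge0_integralZl// ?lee_fin//; [exact/measurable_EFinP|move=> x _; rewrite lee_fin].
Qed.

End pairing.

Section super_brownian_motion.
Context (R : realType) (d : nat) (g : R) (g01 : 0 < g < 1).
Context (dO : measure_display) (Omega : measurableType dO) (P : probability Omega R).
Context (V : (euclidean R d -> R) -> R -> euclidean R d -> R).
Context (F : R -> set (set Omega)).
Context (X : R -> Omega -> {measure set (euclidean R d) -> \bar R}).
Hypothesis log_laplaceV : log_laplace_semigroup g V.
Hypothesis sbmX : super_brownian_motion P V F X.

Let F_measurable t : 0 <= t -> F t `<=` measurable.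
Proof. by case: sbmX => -[+ _] _ _ _ => /[apply] -[]. Qed.

Let F_mono s t : 0 <= s -> s <= t -> F s `<=` F t.
Proof. by case: sbmX => -[_ +] _ _ _; apply. Qed.

Let adapted t A B : 0 <= t -> measurable A -> measurable B ->
  F t ((fun w => X t w A) @^-1` B).
Proof. by case: sbmX => _ + _ _; apply. Qed.

Let laplace s t f A : 0 <= s -> 0 < t -> admissible f -> F s A ->
  A `<=` [set w | X s w setT < +oo]%E ->
  (\int[P]_(w in A) expeR (- pairing (X (s + t)%R w) f) =
   \int[P]_(w in A) expeR (- pairing (X s w) (V f t)))%E.
Proof. by case: sbmX => _ _ + _; apply. Qed.

Lemma measurable_pairing t (f : euclidean R d -> R) : 0 <= t ->
  measurable_fun setT f -> (forall x, 0 <= f x) ->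
  measurable_fun setT (fun w => pairing (X t w) f).
Proof.
move=> t0 mf f0.
apply: (@measurable_fun_integral_kernel _ _ _ _ _ (X t) _ (EFin \o f)).
- by move=> U mU _ B mB; rewrite setTI; exact/F_measurable/adapted.
- by move=> x; rewrite /= lee_fin.
- exact/measurable_EFinP.
Qed.

Lemma measurable_mass t : 0 <= t -> measurable_fun setT (fun w => X t w setT).
Proof. by move=> t0 _ B mB; rewrite setTI; exact/F_measurable/adapted. Qed.

Let measurable_lt_oo (h : Omega -> \bar R) : measurable_fun setT h ->
  measurable [set w | h w < +oo]%E.
Proof.
move=> mh; rewrite -[X in measurable X]setTI.
exact: emeasurable_fun_infty_o.
Qed.

(** The integral over [A] of exp (- l Z) recovers P(A, Z < oo) as [l] tends to 0. Each such integral
    obeys the bound, because the solution with data [l f] dominates the flow from 0 for every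
    [l > 0]. *)
Lemma survival_le s t f A (K : R) : 0 <= s -> 0 < t -> admissible f -> F s A ->
  0 <= K -> (forall w, A w -> K%:E <= X s w setT < +oo)%E ->
  (P (A `&` [set w | pairing (X (s + t) w) f < +oo]) <=
   (expR (- (K * flow g 0 t)))%:E * P A)%E.
Proof.
move=> s0 t0 f_adm FA K0 AK.
have st0 : 0 <= s + t by rewrite addr_ge0// ltW.
have mA := F_measurable s0 FA.
have [mf f0 _ _] := f_adm.
have mZ := measurable_pairing st0 mf f0.
have A_fin : A `<=` [set w | X s w setT < +oo]%E.
  by move=> w /AK/andP[].
have transform (l : R) : 0 < l ->
    (\int[P]_(w in A) expeR (- (l%:E * pairing (X (s + t) w) f)) <=
     (expR (- (K * flow g 0 t)))%:E * P A)%E.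
  move=> l0; have lf_adm := admissible_scale f_adm l0.
  rewrite -integral_cst//.
  rewrite (_ : \int[P]_(w in A) _ =
      \int[P]_(w in A) expeR (- pairing (X s w) (V (fun x => l * f x)%R t)))%E; last first.
    rewrite -laplace//; apply: eq_integral => w _.
    by rewrite pairing_scale// ltW.
  apply: nonneg_integral_mono => //.
  - by move=> w _; exact: expeR_ge0.
  - by move=> w _; rewrite lee_fin expR_ge0.
  move=> w /AK/andP[KY _]; rewrite -[leRHS]/(expeR (- (K * flow g 0 t))%:E).
  rewrite lee_expeR EFinN leeN2.
  have [sol _] := log_laplaceV lf_adm.
  apply: (le_trans _ (pairing_ge (X s w) (flow_ge0 g 0 t)
    (fun x => solution_ge_flow g01 lf_adm sol x t0))).
  by rewrite mulrC EFinM lee_wpmul2l// lee_fin flow_ge0.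
pose B n := A `&` [set w | pairing (X (s + t) w) f <= n%:R%:E]%E.
have mB n : measurable (B n).
  apply: measurableI => //.
  rewrite -[X in measurable X]setTI.
  exact: emeasurable_fun_infty_c.
have -> : A `&` [set w | pairing (X (s + t) w) f < +oo]%E = \bigcup_n B n.
  apply/seteqP; split=> w.
  - move=> [Aw] /=.
    have : (0 <= pairing (X (s + t) w) f)%E.
      by apply: integral_ge0 => x _; rewrite lee_fin.
    case E : (pairing (X (s + t) w) f) => [z| |]//; rewrite lee_fin => z0 _.
    exists (Num.truncn z).+1 => //; split=> //=.
    by rewrite E lee_fin ltW// truncnS_gt.
  - move=> [n _ [Aw /= Zn]]; split=> //=.
    by rewrite (le_lt_trans Zn) ?ltry.
apply: le_measure_bigcup => // n.
  move=> w [Aw /= Zn]; split=> //=.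
  by rewrite (le_trans Zn)// lee_fin ler_nat.
apply/lee_mul01Pr => // r /andP[r0 r1].
(* With this [l], exp (- l Z) >= r on Z <= n, where [r < 1] is arbitrary. Dividing by n + 1 covers n
   = 0. *)
pose l := - ln r / n.+1%:R.
have l0 : 0 < l by rewrite divr_gt0// oppr_gt0 ln_lt0// r0.
apply: le_trans (transform l l0).
rewrite -integral_cst//; apply: nonneg_integral_mono => //.
- exact: subIsetl.
- by move=> w _; rewrite lee_fin ltW.
- by move=> w _; exact: expeR_ge0.
move=> w [Aw /= Zn].
have -> : r%:E = expeR (- (- ln r)%:E) by rewrite -EFinN opprK /= lnK.
rewrite lee_expeR leeN2; apply: (le_trans (lee_wpmul2l _ Zn)).
  by rewrite lee_fin ltW.
rewrite -EFinM lee_fin /l -mulrA ler_piMr ?oppr_ge0 ?ln_le0 ?(ltW r1)//.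
by rewrite mulrC ler_pdivrMr// mul1r ler_nat.
Qed.

Let measurable_finite_mass t : 0 <= t -> measurable [set w | X t w setT < +oo]%E.
Proof. by move=> t0; exact/measurable_lt_oo/measurable_mass. Qed.

(** * Infinite mass and infinite pairing at a fixed time *)

Section deterministic_initial_state.
Variable mu : {finite_measure set (euclidean R d) -> \bar R}.
Hypothesis X0 : \forall w \ae P, forall A, measurable A -> X 0 w A = mu A.
Context (f : euclidean R d -> R) (f_adm : admissible f).

(** The Markov property is applied on an event of [F 0] where the initial mass is known. The almost
    sure set in [X0] need not be one; this event of full measure is. *)
Let start : set Omega := [set w | X 0 w setT = mu setT].
Let K := fine (mu setT).

Let mu_fin : mu setT = K%:E. Proof. by rewrite fineK// fin_num_measure. Qed.

Let F0_start : F 0 start.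
Proof. exact: (adapted (lexx 0) measurableT (emeasurable_set1 (mu setT))). Qed.

Let m_start : measurable start. Proof. exact: F_measurable F0_start. Qed.

(** For constant data [l] the Laplace functional is explicit, and exp (- l Y) is at most the
    indicator of Y < oo; letting [l] tend to 0 gives the bound converse to [survival_le]. *)
Lemma survival_mass_ge t : 0 < t ->
  ((expR (- (K * flow g 0 t)))%:E * P start <=
   P (start `&` [set w | X t w setT < +oo]))%E.
Proof.
move=> t0; set B := [set w | X t w setT < +oo]%E.
have mB : measurable B by exact/measurable_finite_mass/ltW.
have P_fin A : measurable A -> P A \is a fin_num by move=> mA; exact: fin_num_measure.
have mass_l (l : R) : 0 < l ->
    expR (- (K * flow g (l `^ (1 - g)) t)) * fine (P start) <= fine (P (start `&` B)).
  move=> l0; have l_adm := admissible_cst f_adm l0.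
  have [_ uniq] := log_laplaceV l_adm.
  have Vl : V (fun=> l) t = fun=> flow g (l `^ (1 - g)) t.
    apply/funext => x; apply/esym.
    exact: (uniq _ (log_laplace_solution_flow d g01 l0)).
  rewrite -lee_fin EFinM !fineK ?P_fin//; last exact: measurableI.
  rewrite -integral_cst// setIC -integral_indic//.
  rewrite (_ : \int[P]_(w in start) cst _ w =
      \int[P]_(w in start) expeR (- pairing (X (0 + t) w) (fun=> l)))%E.
    apply: nonneg_integral_mono => //.
      by move=> w _; exact: expeR_ge0.
    move=> w _; rewrite add0r pairing_cst indicE; case: (pselect (B w)) => Bw.
      rewrite mem_set// -[leRHS]expeR0 lee_expeR leeNl oppe0 mule_ge0//.
      by rewrite lee_fin ltW.
    rewrite memNset//; have -> : X t w setT = +oo%E.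
      by apply/eqP; rewrite -leye_eq leNgt; exact/negP.
    by rewrite gt0_muley ?lte_fin.
  rewrite laplace//; last by move=> w sw; rewrite /= sw mu_fin ltry.
  apply: eq_integral => w /set_mem sw.
  by rewrite Vl pairing_cst sw mu_fin -EFinM -EFinN mulrC.
rewrite -[P start]fineK ?P_fin// -[leRHS]fineK ?P_fin//; last exact: measurableI.
rewrite -EFinM lee_fin.
have : expR (- (K * flow g (l `^ (1 - g)) t)) * fine (P start) @[l --> (0 : R)^'+]
    --> expR (- (K * flow g 0 t)) * fine (P start).
  apply: cvgM; last exact: cvg_cst.
  apply: continuous_cvg; first exact: continuous_expR.
  by apply: cvgN; apply: cvgM; [exact: cvg_cst|exact: flow_cvg_initial].
by move=> /cvgr_to_le; apply; near=> l; exact: mass_l.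
Unshelve. all: by end_near. Qed.

(** On [start], finite mass implies finite pairing since [f] is bounded, while the two survival
    bounds give the opposite inequality of probabilities. Hence the two events differ by a null
    set. *)
Lemma negligible_infinite_mass_finite_pairing t : 0 < t ->
  P.-negligible [set w | X t w setT = +oo /\ pairing (X t w) f < +oo]%E.
Proof.
move=> t0; have [mf f0 [M fM] _] := f_adm.
set B := [set w | X t w setT < +oo]%E.
set C := [set w | pairing (X t w) f < +oo]%E.
have mB : measurable B by exact/measurable_finite_mass/ltW.
have mC : measurable C by apply/measurable_lt_oo/measurable_pairing => //; exact: ltW.
have BC : start `&` B `<=` start `&` C.
  move=> w [sw Bw]; split=> //; rewrite /C/=.
  apply: (le_lt_trans (pairing_le _ f0 fM)).
  have : X t w setT \is a fin_num by rewrite ge0_fin_numE.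
  by move=> /fineK <-; rewrite -EFinM ltry.
have le_CB : (P (start `&` C) <= P (start `&` B))%E.
  apply: (le_trans _ (survival_mass_ge t0)).
  have -> : C = [set w | pairing (X (0 + t) w) f < +oo]%E by rewrite add0r.
  apply: survival_le => //; first exact: fine_ge0.
  by move=> w sw; rewrite sw mu_fin lexx ltry.
have null : P.-negligible ((start `&` C) `\` (start `&` B)).
  apply/negligibleP; first by apply: measurableD; exact: measurableI.
  have finC : (P (start `&` C) < +oo)%E.
    by rewrite -ge0_fin_numE// fin_num_measure//; exact: measurableI.
  apply/eqP; rewrite -measure_le0 measureD//; [|exact: measurableI|exact: measurableI].
  by rewrite (setIidr BC) sube_le0.
have null0 : P.-negligible (~` start).
  by apply: negligibleS X0 => w /= + sw; apply; exact: sw.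
apply: negligibleS (negligibleU null null0) => w [Yoo Zfin].
have [sw|sw] := pselect (start w); [left; split=> // -[_]|by right].
by rewrite /B/= Yoo ltxx.
Qed.

End deterministic_initial_state.

(** * Crossings of high levels on time grids *)

Definition grid (n k : nat) : R := k%:R / n.+1%:R.

Lemma grid_ge0 n k : 0 <= grid n k.
Proof. by rewrite divr_ge0. Qed.

Lemma le_grid n j k : (j <= k)%N -> grid n j <= grid n k.
Proof. by move=> jk; rewrite ler_wpM2r ?invr_ge0// ler_nat. Qed.

(** Whether [k] is the first index whose event occurs is known at the [k]-th grid time, since
    earlier events belong to earlier sigma-algebras. *)
Lemma filtration_seqDU n k q (A : nat -> set Omega) : grid n k <= q ->
  (forall j, grid n j <= q -> F (grid n j) (A j)) ->
  F (grid n k) (seqDU A k).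
Proof.
move=> kq FA; have sF : sigma_algebra setT (F (grid n k)).
  by case: sbmX => -[+ _] _ _ _ => /(_ _ (grid_ge0 n k))[].
have FE : @measurable _ (g_sigma_algebraType (F (grid n k))) = F (grid n k).
  exact: sigma_algebra_id.
have mA j : (j <= k)%N ->
    @measurable _ (g_sigma_algebraType (F (grid n k))) (A j).
  move=> jk; rewrite FE; apply: (F_mono (grid_ge0 n j) (le_grid n jk)).
  by apply: FA; exact: le_trans (le_grid n jk) kq.
rewrite -FE; apply: measurableD; first exact: mA.
by apply: bigsetU_measurable => i _; exact: (mA _ (ltnW (ltn_ord i))).
Qed.

Section crossing.
Context (f : euclidean R d -> R) (f_adm : admissible f).

(** Finite mass is part of a crossing because the Markov property is available only where the mass
    is finite. *)
Definition crossing (K q1 : R) n : set Omega :=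
  \bigcup_k [set w | (grid n k <= q1)%R /\ K%:E <= X (grid n k) w setT < +oo]%E.

Let level K q1 n k : set Omega :=
  [set w | (grid n k <= q1)%R /\ K%:E <= X (grid n k) w setT < +oo]%E.

Let F_level K q1 n k : grid n k <= q1 -> F (grid n k) (level K q1 n k).
Proof.
move=> kq; have -> : level K q1 n k = (fun w => X (grid n k) w setT) @^-1` `[K%:E, (+oo)%E[.
  by apply/seteqP; split=> w; rewrite /level/= in_itv/=; [case|split].
exact: adapted (grid_ge0 n k) measurableT (emeasurable_itv _).
Qed.

Let measurable_level K q1 n k : measurable (level K q1 n k).
Proof.
have [kq|kq] := leP (grid n k) q1; first exact: (F_measurable (grid_ge0 n k) (F_level K kq)).
rewrite (_ : level _ _ _ _ = set0)//; apply/seteqP; split=> // w [].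
by rewrite leNgt kq.
Qed.

Lemma measurable_crossing K q1 n : measurable (crossing K q1 n).
Proof. by apply: bigcup_measurable => k _; exact: measurable_level. Qed.

(* Splitting according to the first crossing time, each piece is an event of
   the past to which the survival bound applies. *)
Lemma crossing_survival_le K q1 q n : 0 <= K -> q1 < q ->
  (P (crossing K q1 n `&` [set w | pairing (X q w) f < +oo]) <=
   (expR (- (K * flow g 0 (q - q1))))%:E)%E.
Proof.
move=> K0 q1q; set G := [set w | pairing (X q w) f < +oo]%E.
set e := expR _.
(* Grid times are nonnegative, so no crossing occurs when [q < 0]. *)
have [q0|q0] := ltP q 0.
  rewrite (_ : _ `&` _ = set0) ?measure0 ?lee_fin ?expR_ge0//.
  apply/seteqP; split=> // w [[k _ [kq _]] _].
  by have := le_lt_trans (le_trans (grid_ge0 n k) kq) (lt_trans q1q q0); rewrite ltxx.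
have [mf f0 _ _] := f_adm.
have mG : measurable G by apply/measurable_lt_oo/measurable_pairing.
pose D := seqDU (level K q1 n).
have mD k : measurable (D k) by exact: seqDU_measurable.
have tD : trivIset setT D by exact: trivIset_seqDU.
have -> : crossing K q1 n = \bigcup_k D k by exact: seqDU_bigcup_eq.
rewrite setI_bigcupl measure_semi_bigcup//; first last.
- by apply: bigcup_measurable => k _; exact: measurableI.
- exact: trivIset_setIr.
- by move=> k; exact: measurableI.
apply: (@le_trans _ _ (\sum_(0 <= k <oo) (e%:E * P (D k)))%E).
  apply: lee_nneseries => // k _.
  have [kq|kq] := leP (grid n k) q1; last first.
    rewrite (_ : D k = set0) ?set0I ?measure0 ?mule0//.
    apply/seteqP; split=> // w [[]].
    by rewrite leNgt kq.
  have -> : G = [set w | pairing (X (grid n k + (q - grid n k)) w) f < +oo]%E.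
    by rewrite addrC subrK.
  have rest : 0 < q - grid n k by rewrite subr_gt0 (le_lt_trans kq).
  have FD : F (grid n k) (D k) by apply: (filtration_seqDU kq) => j jq; exact: F_level.
  have DK w : D k w -> (K%:E <= X (grid n k) w setT < +oo)%E by case=> -[].
  apply: (le_trans (survival_le (grid_ge0 n k) rest f_adm FD K0 DK)).
  apply: lee_wpmul2r; first exact: measure_ge0.
  (* At least q - q1 remains after a grid time up to [q1], and the flow is nondecreasing. *)
  rewrite lee_fin ler_expR lerN2; apply: ler_wpM2l; first exact: K0.
  apply: le_flow; [exact: g01|exact: lexx|by rewrite subr_ge0 ltW|].
  by rewrite lerD2l lerN2.
rewrite nneseriesZl//.
rewrite -measure_semi_bigcup//; last exact: bigcup_measurable.
rewrite -[leRHS]mule1 lee_wpmul2l ?lee_fin ?expR_ge0// probability_le1//.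
exact: bigcup_measurable.
Qed.

(** Crossing on all fine grids is a union over [N] of increasing events, so each level [K] inherits
    the bound exp (- K c(q - q1)), which is uniform in the grid. Then [K] is arbitrary. *)
Lemma negligible_crossings q1 q : q1 < q ->
  P.-negligible [set w | pairing (X q w) f < +oo /\
    forall K : nat, exists N, forall n, (N <= n)%N -> crossing K%:R q1 n w]%E.
Proof.
move=> q1q; have [q0|q0] := ltP q 0.
  rewrite (_ : mkset _ = set0); first exact: negligible_set0.
  apply/seteqP; split=> // w [_ /(_ 0)[N /(_ N (leqnn N))[k _ [kq _]]]].
  by have := le_lt_trans (le_trans (grid_ge0 N k) kq) (lt_trans q1q q0); rewrite ltxx.
have [mf f0 _ _] := f_adm.
pose G := [set w | pairing (X q w) f < +oo]%E.
have mG : measurable G by apply/measurable_lt_oo/measurable_pairing.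
pose B K N := \bigcap_(n in [set n | (N <= n)%N]) (crossing K q1 n `&` G).
have mB K N : measurable (B K N).
  apply: bigcap_measurable => [|n _]; first by exists N => /=.
  by apply: measurableI => //; exact: measurable_crossing.
pose U (K : nat) := \bigcup_N B K%:R N.
have mU K : measurable (U K) by exact: bigcup_measurable.
have PU K : (P (U K) <= (expR (- (K%:R * flow g 0 (q - q1))))%:E)%E.
  apply: le_measure_bigcup => // N.
    by move=> w BN n /= Nn; apply: BN; exact: leq_trans Nn.
  apply: le_trans (crossing_survival_le N _ q1q) => //.
  apply: le_measure; rewrite ?inE//; first exact/measurableI/mG/measurable_crossing.
  by move=> w; apply => /=.
exists (\bigcap_K U K); split.
- exact: bigcap_measurable.
- have flow0 : 0 < flow g 0 (q - q1) by rewrite flow_gt0// subr_gt0.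
  apply/eqP; rewrite eq_le measure_ge0 andbT; apply/lee_addgt0Pr => e e0.
  rewrite add0r.
  (* Then (K + 1) c(q - q1) >= 1 / e, and exp x >= 1 + x brings the bound at level K + 1 below
     [e]. *)
  pose K := Num.truncn ((e * flow g 0 (q - q1))^-1).
  apply: (@le_trans _ _ (P (U K.+1))).
    by apply: le_measure; rewrite ?inE//; [exact: bigcap_measurable|move=> w; exact].
  apply: (le_trans (PU _)); rewrite lee_fin expRN.
  rewrite -[leRHS]invrK lef_pV2 ?posrE ?invr_gt0 ?expR_gt0//.
  apply: le_trans (expR_ge1Dx _); apply: ler_wpDl => //.
  rewrite -ler_pdivrMr// -invfM ltW//.
  exact: truncnS_gt.
- move=> w /= [Zfin cross] K _; have [N hN] := cross K.
  by exists N => // n /= Nn; split=> //; exact: hN.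
Qed.

End crossing.

End super_brownian_motion.

(** * Comparison of the two explosion times *)

Lemma grid_between (R : realType) (s u : R) : 0 <= s -> s < u ->
  exists N, forall n, (N <= n)%N -> exists k, s < grid R n k /\ grid R n k.+1 < u.
Proof.
move=> s0 su; have us0 : 0 < u - s by rewrite subr_gt0.
(* The mesh is below half of u - s, so the first grid point after [s] and its successor both precede
   [u]. *)
exists (Num.truncn (2 / (u - s))) => n Nn.
have n0 : 0 < n.+1%:R :> R by rewrite ltr0n.
have n2 : 2 / n.+1%:R < u - s.
  rewrite ltr_pdivrMr// mulrC -ltr_pdivrMr//.
  by rewrite (lt_le_trans (truncnS_gt _))// ler_nat ltnS.
have sn0 : 0 <= s * n.+1%:R by rewrite mulr_ge0.
exists (Num.truncn (s * n.+1%:R)).+1; split.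
  by rewrite /grid ltr_pdivlMr// truncnS_gt.
have /andP[le_sn _] := truncn_itv sn0.
rewrite /grid -addn2 natrD mulrDl -ltrBrDr (le_lt_trans (y := s))//; last first.
  by rewrite ltrBrDr addrC -ltrBrDr.
by rewrite ler_pdivrMr.
Qed.

Theorem lemma3p6 (R : realType) (d : nat) (gamma : R)
    (dO : measure_display) (Omega : measurableType dO)
    (P : probability Omega R)
    (V : (euclidean R d -> R) -> R -> euclidean R d -> R)
    (F : R -> set (set Omega))
    (X : R -> Omega -> {measure set (euclidean R d) -> \bar R})
    (mu : {finite_measure set (euclidean R d) -> \bar R}) (f : euclidean R d -> R)
    (d_ge1 : (1 <= d)%N) (gamma01 : 0 < gamma < 1)
    (logLaplaceV : log_laplace_semigroup gamma V)
    (sbmX : super_brownian_motion P V F X)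
    (X0 : \forall w \ae P, forall A, measurable A -> X 0 w A = mu A)
    (f_test : admissible f) :
  P.-negligible [set w | explosion_time X (fun=> 1) w <> explosion_time X f w].
Proof.
have [_ f0 [M fM] _] := f_test.
have [_ _ _ right_cont] := sbmX.
have fixed_times : \forall w \ae P, forall n k, 0 < grid R n k ->
    ~ (X (grid R n k) w setT = +oo /\ pairing (X (grid R n k) w) f < +oo)%E.
  apply: ae_foralln => n; apply: ae_foralln => k.
  have [t0|_] := ltP 0 (grid R n k); last exact: aeW.
  have := negligible_infinite_mass_finite_pairing gamma01 logLaplaceV sbmX X0 f_test t0.
  by apply: negligibleS => w /= /not_implyP[_ /contrapT].
(* Consecutive grid points serve as q1 < q, so only countably many null sets are removed. *)
have crossings : \forall w \ae P, forall n k, ~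
    (pairing (X (grid R n k.+1) w) f < +oo /\ forall K : nat,
       exists N, forall m, (N <= m)%N -> crossing X K%:R (grid R n k) m w)%E.
  apply: ae_foralln => n; apply: ae_foralln => k.
  have nk : grid R n k < grid R n k.+1 by rewrite /grid ltr_pM2r ?invr_gt0// ltr_nat.
  have := negligible_crossings gamma01 logLaplaceV sbmX f_test nk.
  by apply: negligibleS => w /= /contrapT.
suff : \forall w \ae P, explosion_time X (fun=> 1) w = explosion_time X f w by [].
apply: filterS3 fixed_times crossings right_cont => w fixed_times crossings right_cont.
apply/eqP; rewrite eq_le; apply/andP; split.
  (* As [f] is bounded, an infinite pairing with [f] forces an infinite mass. *)
  apply: ereal_inf_le_tmp => _ [t [t0 Zt] <-]; exists t => //; split=> //.
  apply/eqP; rewrite pairing_cst mul1e -leye_eq leNgt; apply/negP => Yt.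
  have := pairing_le (X t w) f0 fM; rewrite Zt leye_eq => /eqP.
  have /fineK <- : X t w setT \is a fin_num by rewrite ge0_fin_numE.
  by rewrite -EFinM.
(* [s] is a time of infinite mass before T(f); the infimum T(1) itself need not be attained. *)
rewrite leNgt; apply/negP => /ereal_inf_lt[_ [s [s0 Ys] <-] sT].
move: Ys; rewrite pairing_cst mul1e => Ys.
have Zfin t : 0 <= t -> (t%:E < explosion_time X f w)%E -> (pairing (X t w) f < +oo)%E.
  move=> t0; rewrite ltNge => tT; rewrite ltNge leye_eq; apply/negP => /eqP Zt.
  by move/negP: tT; apply; apply: ereal_inf_lbound; exists t.
have [u su uT] : exists2 u, s < u & (u%:E <= explosion_time X f w)%E.
  move: sT; case: (explosion_time X f w) => [r| |]//.
    by rewrite lte_fin => sr; exists r.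
  by move=> _; exists (s + 1); rewrite ?ltrDl// leey.
(* This gives s < q1 < q < u, with q1 and q the grid points of index [k0] and [k0.+1]. *)
have [n0 /(_ n0 (leqnn n0))[k0 [sq1 qu]]] := grid_between s0 su.
have before t : 0 <= t -> t < u -> (pairing (X t w) f < +oo)%E.
  by move=> t0 tu; apply: Zfin => //; rewrite (lt_le_trans _ uT)// lte_fin.
apply: (crossings n0 k0); split; first by apply: before => //; exact: grid_ge0.
move=> K.
have : pairing (X t w) (fun=> 1) @[t --> s^'+] --> pairing (X s w) (fun=> 1).
  apply: right_cont => //; first by exists 1.
  exact: cst_continuous.
rewrite [pairing (X s w) _]pairing_cst mul1e Ys.
(* Right-continuity keeps the mass above [K] on some interval to the right of [s]; every fine enough
   grid has a point in it before q1. *)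
move=> /cvgeyPger /(_ K%:R (num_real _)) [e /= e0 near_s].
have [N hN] := @grid_between _ s (Num.min (s + e) (grid R n0 k0)) s0
  ltac:(by rewrite lt_min ltrDl e0).
exists N => n /hN[k [sk]].
have kk : grid R n k < grid R n k.+1 by rewrite /grid ltr_pM2r ?invr_gt0// ltr_nat.
rewrite lt_min => /andP[/(lt_trans kk) ke /(lt_trans kk) kq1].
exists k => //; split; first exact: ltW.
apply/andP; split.
  have := near_s (grid R n k); rewrite /= pairing_cst mul1e; apply => //.
  by rewrite ltr_distlC; rewrite (lt_trans _ sk) ?ltrBlDr ?ltrDl//=.
(* An infinite mass at this grid time would make the pairing with [f] infinite before T(f). *)
rewrite ltNge leye_eq; apply/negP => /eqP Yk.
apply: (fixed_times n k); first exact: le_lt_trans sk.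
split=> //; apply: before; first exact: grid_ge0.
rewrite (lt_trans kq1)// (lt_trans _ qu)//.
by rewrite /grid ltr_pM2r ?invr_gt0// ltr_nat.
Qed.
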